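(* Let $H_1,\dots,H_m$ be convex Hamiltonians and assume that the coupling matrix $B$ is independent of $x$. For every $\boldsymbol\lambda=(\lambda_1,\dots,\lambda_m)\in\mathbb R^m$, denote by $c_{\boldsymbol\lambda}$ and $\mathcal A_{\boldsymbol\lambda}$ the critical value and the Aubry set of the weakly coupled system with $H_i-\lambda_i$ in place of $H_i$ for every $i\in\{1,\dots,m\}$. Then $$c_{\boldsymbol\lambda}=c_{\mathbf 0}-\pi(\boldsymbol\lambda)\qquad\text{and}\qquad\mathcal A_{\boldsymbol\lambda}=\mathcal A_{\mathbf 0}\qquad\text{for every }\boldsymbol\lambda\in\mathbb R^m,$$ where $\pi(\boldsymbol\lambda)$ denotes the unique real number such that $\boldsymbol\lambda-\pi(\boldsymbol\lambda)\mathbb 1\in\mathrm{Im}(B)$.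
   Context: Let $N,m$ be positive integers, $\mathbb T^N=\mathbb R^N/\mathbb Z^N$ the flat torus, $\mathbb 1=(1,\dots,1)^T\in\mathbb R^m$. A convex (and coercive) Hamiltonian is a continuous $H:\mathbb T^N\times\mathbb R^N\to\mathbb R$ such that $p\mapsto H(x,p)$ is convex for every $x$ and there are $\alpha,\beta:\mathbb R_+\to\mathbb R$ tending to $+\infty$ at $+\infty$ with $\alpha(|p|)\leqslant H(x,p)\leqslant\beta(|p|)$ for all $(x,p)$. An $m\times m$ real matrix $(b_{ij})$ is a coupling matrix if $b_{ij}\leqslant0$ for $j\ne i$ and $\sum_j b_{ij}\geqslant0$ for every $i$; it is degenerate if moreover $\sum_j b_{ij}=0$ for every $i$; a matrix is irreducible if for every nonempty $\mathcal I\subsetneq\{1,\dots,m\}$ there are $i\in\mathcal I$, $j\notin\mathcal I$ with $b_{ij}\neq0$. Here $B=(b_{ij})$ is a constant irreducible degenerate coupling matrix. For continuous $u$, $D^+u(x_0)$ (resp. $D^-u(x_0)$) is the set of $D\phi(x_0)$ with $\phi$ of class $C^1$ near $x_0$ and $u-\phi$ having a local maximum (resp. minimum) at $x_0$. Given convex Hamiltonians $G_1,\dots,G_m$ and $a\in\mathbb R$, $\mathbf u\in(C(\mathbb T^N))^m$ is a (viscosity) subsolution [resp. supersolution] of $G_i(x,Du_i)+(B\mathbf u(x))_i=a$ in $\mathbb T^N$, $i=1,\dots,m$, if for all $x$ and $i$: $G_i(x,p)+(B\mathbf u(x))_i\leqslant a$ for all $p\in D^+u_i(x)$ [resp. $\geqslant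 a$ for all $p\in D^-u_i(x)$]; a solution is both. $\mathcal H(a)$ denotes the set of subsolutions. The critical value of this weakly coupled system is $c=\inf\{a\in\mathbb R:\mathcal H(a)\neq\varnothing\}$ (a finite number with $\mathcal H(c)\ne\varnothing$). Set $\Phi_{i,j}(y,x)=\sup_{\mathbf v\in\mathcal H(c)}\big(v_i(x)-v_j(y)\big)$ and $\Phi_{\cdot,j}(y,\cdot)=(\Phi_{1,j}(y,\cdot),\dots,\Phi_{m,j}(y,\cdot))^T$. The Aubry set of the system is the set of $y\in\mathbb T^N$ such that $\Phi_{\cdot,i}(y,\cdot)$ is a solution of the system with $a=c$, where $i$ is any fixed index (the set does not depend on $i$). *)

(* Defs.v *)
From HB Require Import structures.
From mathcomp Require Import all_boot all_order all_algebra.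
From mathcomp Require Import all_classical all_reals all_analysis.

Set Implicit Arguments.
Unset Strict Implicit.
Unset Printing Implicit Defensive.

Import Order.TTheory GRing.Theory Num.Theory.
Import numFieldNormedType.Exports.

Local Open Scope classical_set_scope.
Local Open Scope ring_scope.

Section Hamiltonians.
Context {R : realType} {N : nat}.
Implicit Types (u phi : 'rV[R]_N -> R) (x p : 'rV[R]_N).

(* Functions on the flat torus R^N / Z^N are represented by their Z^N-periodic
   lifts to R^N, and subsets of the torus by Z^N-invariant subsets of R^N. *)
Definition torus_periodic {T : zmodType} (f : 'rV[R]_N -> T) : Prop :=
  forall k : 'rV[int]_N, periodic f (map_mx intr k).

(* The library norm `|p| on row vectors is the sup norm. *)
Definition euclidean_norm p : R := Num.sqrt (\sum_(i < N) p 0 i ^+ 2).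

Definition convex_hamiltonian (H : 'rV[R]_N -> 'rV[R]_N -> R) : Prop :=
  [/\ forall p, torus_periodic (fun x => H x p),
      continuous (fun z : 'rV[R]_N * 'rV[R]_N => H z.1 z.2),
      forall x, convex_function setT (H x : convex_lmodType 'rV[R]_N -> R^o) &
      exists alpha beta : R -> R,
        [/\ alpha r @[r --> +oo] --> +oo,
            beta r @[r --> +oo] --> +oo &
            forall x p, alpha (euclidean_norm p) <= H x p
                        /\ H x p <= beta (euclidean_norm p)]].

Definition gradient phi x : 'rV[R]_N :=
  \row_(i < N) 'D_(delta_mx 0 i) phi x.

Definition C1_near phi x : Prop :=
  \forall y \near x, differentiable phi y /\ {for y, continuous (gradient phi)}.

Definition superdifferential u x : set 'rV[R]_N :=
  [set p | exists phi, [/\ C1_near phi x, gradient phi x = p &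
     \forall y \near x, u y - phi y <= u x - phi x]].

Definition subdifferential u x : set 'rV[R]_N :=
  [set p | exists phi, [/\ C1_near phi x, gradient phi x = p &
     \forall y \near x, u x - phi x <= u y - phi y]].

End Hamiltonians.

Section CouplingMatrices.
Context {R : realType} {m : nat}.
Implicit Types (B : 'M[R]_m).

Definition coupling_matrix B : Prop :=
  (forall i j, j != i -> B i j <= 0) /\ (forall i, 0 <= \sum_j B i j).

Definition degenerate_coupling_matrix B : Prop :=
  coupling_matrix B /\ forall i, \sum_j B i j = 0.

Definition irreducible_matrix B : Prop :=
  forall I : {set 'I_m}, I != finset.set0 -> I \proper [set: 'I_m]%SET ->
    exists i j, [/\ i \in I, j \notin I & B i j != 0].

End CouplingMatrices.

Section WeaklyCoupledSystem.
Context {R : realType} {N m : nat}.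
Variables (G : 'I_m -> 'rV[R]_N -> 'rV[R]_N -> R) (B : 'M[R]_m).
Implicit Types (u : 'I_m -> 'rV[R]_N -> R) (a : R).

Definition torus_continuous u : Prop :=
  forall i, continuous (u i) /\ torus_periodic (u i).

Definition coupling u (x : 'rV[R]_N) : 'cV[R]_m := B *m \col_j u j x.

Definition subsolution a u : Prop :=
  torus_continuous u /\
  forall x i p, superdifferential (u i) x p -> G i x p + coupling u x i 0 <= a.

Definition supersolution a u : Prop :=
  torus_continuous u /\
  forall x i p, subdifferential (u i) x p -> a <= G i x p + coupling u x i 0.

Definition solution a u : Prop := subsolution a u /\ supersolution a u.

Definition critical_value : R := inf [set a | exists u, subsolution a u].

(* The supremum is taken in the extended reals, so that no value is
   assigned by convention to an empty or unbounded family. *)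
Definition Phi (i j : 'I_m) (y x : 'rV[R]_N) : \bar R :=
  ereal_sup [set (v i x - v j y)%:E | v in subsolution critical_value].

(* Aubry set computed with reference index j; Phi_{.,j}(y,.) being a solution
   includes its being real-valued. *)
Definition aubry_set (j : 'I_m) : set 'rV[R]_N :=
  [set y | exists u, (forall i x, Phi i j y x = (u i x)%:E)
                     /\ solution critical_value u].

End WeaklyCoupledSystem.

(* Main.v *)
Require Import Defs.
From mathcomp Require Import all_boot all_order all_algebra.
From mathcomp Require Import all_classical all_reals all_analysis.
Import Order.TTheory GRing.Theory Num.Theory.
Import numFieldNormedType.Exports.
Local Open Scope classical_set_scope.
Local Open Scope ring_scope.

(** Write [lambda - pi lambda = B v] with [v] a constant vector. Adding [v] to a
    vector function leaves its semidifferentials alone and adds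
    [lambda - pi lambda] to the coupling term, so [u |-> u + v] turns
    subsolutions (supersolutions) of the system of [H] at level [a] into those of
    the system of [H - lambda] at level [a - pi lambda], and [u |-> u - v] goes
    back. Both claims are read off this bijection ([subsolution_shift],
    [supersolution_shift]): the sets of admissible levels are translates of each
    other, hence so are their infima, and [Phi i j] gains the constant
    [v i - v j], that is, the vector [Phi _ j] is shifted by
    [v - v j], which is an admissible shift as well since [B] kills constants
    ([aubry_set_shift_sub]).

    Infima of real sets only translate when the sets are nonempty and bounded
    below. The zero function is a subsolution at a high level, because its only
    supergradient is 0 ([subsolution_zero]). Conversely, comparing each component
    of a subsolution at its maximum point bounds its level from below
    ([subsolution_level_ge]).

    Existence and uniqueness of [pi lambda] say that the constants are a
    complement of the range of [B]. They meet trivially because [B v] is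
    nonnegative in the row of a largest entry of [v] ([const_in_range_eq0]), and
    span everything because irreducibility reduces the kernel of [B] to the
    constants ([kernel_const], [exists_const_mod_range]). *)

Set Implicit Arguments.
Unset Strict Implicit.
Unset Printing Implicit Defensive.

(** * The coupling matrix *)

Lemma mulmx_colE (R : pzSemiRingType) (n : nat) (A : 'M[R]_n) (v : 'cV[R]_n)
    (i : 'I_n) : (A *m v) i 0 = \sum_j A i j * v j 0.
Proof. by rewrite mxE. Qed.

Section CouplingMatrix.
Variables (R : realType) (m : nat) (B : 'M[R]_m).
Hypotheses (m_gt0 : (0 < m)%N) (hB : degenerate_coupling_matrix B).

Lemma mulmx_const_eq0 (a : R) : B *m const_mx a = 0 :> 'cV_m.
Proof.
case: hB => _ B0; apply/colP => i; rewrite mulmx_colE !mxE.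
under eq_bigr do rewrite mxE.
by rewrite -mulr_suml B0 mul0r.
Qed.

Lemma mulmx_col_sub (v : 'cV[R]_m) (a : R) (i : 'I_m) :
  (B *m v) i 0 = \sum_j B i j * (v j 0 - a).
Proof.
rewrite -[v in LHS](subrK (const_mx a)) mulmxDr mulmx_const_eq0 addr0.
by rewrite mulmx_colE; apply: eq_bigr => j _; rewrite !mxE.
Qed.

(** After subtracting the maximal entry, every off-diagonal term is a product
    of two nonpositive numbers and the diagonal one vanishes. *)
Lemma coupling_term_ge0 (v : 'cV[R]_m) (i j : 'I_m) :
  (forall k, v k 0 <= v i 0) -> 0 <= B i j * (v j 0 - v i 0).
Proof.
move=> vmax; case: hB => -[Bneg _] _.
have [->|ji] := eqVneq j i; first by rewrite subrr mulr0.
by apply: mulr_le0; [exact: Bneg | rewrite subr_le0].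
Qed.

Lemma coupling_at_max_ge0 (v : 'cV[R]_m) (i : 'I_m) :
  (forall k, v k 0 <= v i 0) -> 0 <= (B *m v) i 0.
Proof.
move=> vmax; rewrite (mulmx_col_sub _ (v i 0)).
by apply: sumr_ge0 => j _; exact: coupling_term_ge0.
Qed.

Lemma exists_max_entry (v : 'cV[R]_m) : exists i, forall k, v k 0 <= v i 0.
Proof.
have [i _ imax] := @arg_maxP _ R _ (Ordinal m_gt0) xpredT (fun k => v k 0) isT.
by exists i => k; exact: imax.
Qed.

(** Looking at the row of a maximal entry of [v], and of [- v], bounds a
    constant in the range of [B] from both sides. *)
Lemma const_in_range_eq0 (v : 'cV[R]_m) (a : R) :
  B *m v = const_mx a -> a = 0.
Proof.
move=> Bva; apply/eqP; rewrite eq_le; apply/andP; split.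
  have [i /coupling_at_max_ge0] := exists_max_entry (- v).
  by rewrite mulmxN Bva !mxE oppr_ge0.
have [i /coupling_at_max_ge0] := exists_max_entry v.
by rewrite Bva mxE.
Qed.

(** Strong maximum principle: were the set of maximal indices proper,
    irreducibility would give one of its rows a strictly positive term. *)
Lemma kernel_const (hirr : irreducible_matrix B) (v : 'cV[R]_m) :
  B *m v = 0 -> exists a, v = const_mx a.
Proof.
move=> Bv0; have [i0 vmax] := exists_max_entry v.
exists (v i0 0); pose I := [set i | v i 0 == v i0 0]%SET.
have [IT|IT] := eqVneq I [set: 'I_m]%SET.
  apply/colP => i; rewrite mxE; apply/eqP.
  have : i \in I by rewrite IT inE.
  by rewrite inE.
have In0 : I != finset.set0.
  by apply/finset.set0Pn; exists i0; rewrite inE.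
have Ipr : I \proper [set: 'I_m]%SET by rewrite finset.properT.
have [i [j [/[!inE]/eqP iI jI Bij]]] := hirr I In0 Ipr.
have imax k : v k 0 <= v i 0 by rewrite iI.
have := congr1 (fun w : 'cV[R]_m => w i 0) Bv0.
rewrite (mulmx_col_sub _ (v i 0)) mxE => /eqP.
rewrite psumr_eq0; last by move=> k _; exact: coupling_term_ge0.
move=> /allP/(_ j (mem_index_enum j))/=.
by rewrite mulf_eq0 (negPf Bij) subr_eq0 iI (negPf jI).
Qed.

(** Adding to [B] the matrix with all entries 1 makes it injective: a kernel
    vector [v] has [B v] constant, hence 0, so it is itself constant, and its
    entries sum to 0. The entries of a preimage then sum to the wanted
    constant. *)
Lemma exists_const_mod_range (hirr : irreducible_matrix B) (l : 'cV[R]_m) :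
  exists a, exists v : 'cV[R]_m, l - const_mx a = B *m v.
Proof.
have addJ (v : 'cV[R]_m) :
    (B + const_mx 1) *m v = B *m v + const_mx (\sum_j v j 0).
  rewrite mulmxDl; congr (_ + _); apply/colP => i; rewrite mulmx_colE !mxE.
  by apply: eq_bigr => j _; rewrite mxE mul1r.
have Junit : (B + const_mx 1)^T \in unitmx.
  rewrite -row_free_unit; apply: inj_row_free => w wJ0.
  have : (B + const_mx 1) *m w^T = 0.
    by rewrite -[LHS]trmxK trmx_mul trmxK wJ0 trmx0.
  rewrite addJ => /eqP; rewrite addr_eq0 => /eqP Bw.
  have sum0 : \sum_j w^T j 0 = 0.
    apply/eqP; rewrite -oppr_eq0; apply/eqP.
    apply: (@const_in_range_eq0 w^T); rewrite Bw.
    by apply/colP => i; rewrite !mxE.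
  have : B *m w^T = 0 by rewrite Bw sum0; apply/colP => i; rewrite !mxE oppr0.
  move=> /(kernel_const hirr)[a wa]; move: sum0; rewrite wa.
  under eq_bigr do rewrite mxE.
  rewrite sumr_const card_ord => /eqP; rewrite mulrn_eq0 -leqn0 leqNgt m_gt0/=.
  move=> /eqP a0; rewrite -[w]trmxK wa a0.
  by apply/rowP => i; rewrite !mxE.
rewrite unitmx_tr in Junit.
pose z := invmx (B + const_mx 1) *m l.
exists (\sum_j z j 0), z.
by rewrite -[l](mulKVmx Junit) -/z addJ addrK.
Qed.

Lemma const_mod_range_inj (l v w : 'cV[R]_m) (a b : R) :
  l - const_mx a = B *m v -> l - const_mx b = B *m w -> a = b.
Proof.
move=> lv lw; apply/eqP; rewrite -subr_eq0; apply/eqP.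
apply: (@const_in_range_eq0 (w - v)); rewrite mulmxBr -lv -lw.
by apply/colP => i; rewrite !mxE opprB addrC addrA subrK addrC.
Qed.

End CouplingMatrix.

(** * Extrema and semidifferentials *)

Section Semidifferentials.
Variables (R : realType) (N : nat).
Implicit Types (u phi : 'rV[R]_N -> R) (x : 'rV[R]_N).

Lemma differential_const (c : R) x :
  C1_near (fun _ : 'rV[R]_N => c) x /\ gradient (fun _ : 'rV[R]_N => c) x = 0.
Proof.
have g0 y : gradient (fun _ : 'rV[R]_N => c) y = 0.
  by apply/rowP => i; rewrite !mxE; exact: derive_cst.
split=> //; apply: filterE => y; split; first exact: differentiable_cst.
have -> : gradient (fun _ : 'rV[R]_N => c) = cst 0 by exact/funext.
exact: cst_continuous.
Qed.

(** A constant function is an admissible test function at a maximum point. *)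
Lemma superdifferential_at_max u x :
  (forall y, u y <= u x) -> superdifferential u x 0.
Proof.
move=> umax; exists (fun=> 0); have [C1 g0] := differential_const 0 x.
by split=> //; apply: filterE => y; rewrite lerD2r.
Qed.

Lemma directional_derivative_at_min_ge0 phi x (v : 'rV[R]_N) :
  differentiable phi x -> (\forall y \near x, phi x <= phi y) ->
  0 <= 'D_v phi x.
Proof.
move=> dphi phimin; have drv : derivable phi x v := diff_derivable dphi.
(* Positive increments make every difference quotient nonnegative. *)
rewrite /derive cvg_at_rightE //; apply: limr_ge.
  rewrite -(cvg_at_rightE (fun h : R => h^-1 *: ((phi \o shift x) (h *: v) - phi x))) //.
  apply: cvg_trans drv; apply: cvg_app.
  move=> A [e egt0 Ae]; exists e => // h xe hgt0; apply: Ae => //.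
  exact/lt0r_neq0.
have near_line : \forall h \near (0 : R), phi x <= phi (h *: v + x).
  suff line : (fun h : R => h *: v + x) @ 0 --> x by exact: (line _ phimin).
  have : (fun h : R => h *: v + x) @ 0 --> 0 *: v + x.
    by apply: cvgD; [exact: scalel_continuous | exact: cvg_cst].
  by rewrite scale0r add0r.
near=> h; apply: mulr_ge0.
  by rewrite invr_ge0; apply: ltW; near: h; exists 1 => /=.
rewrite subr_ge0 /=; near: h.
exact: cvg_within.
Unshelve. all: by end_near. Qed.

(** Applied to [v] and [- v], the one-sided bound forces equality, the
    derivative being linear in the direction. *)
Lemma gradient_at_min phi x :
  differentiable phi x -> (\forall y \near x, phi x <= phi y) ->
  gradient phi x = 0.
Proof.
move=> dphi phimin; apply/rowP => i; rewrite !mxE; apply/eqP.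
rewrite eq_le directional_derivative_at_min_ge0 // andbT.
have := directional_derivative_at_min_ge0 (- delta_mx 0 i) dphi phimin.
by rewrite !deriveE // linearN oppr_ge0.
Qed.

Lemma superdifferential_const (c : R) x (p : 'rV[R]_N) :
  superdifferential (fun=> c) x p -> p = 0.
Proof.
move=> [phi [/nbhs_singleton[dphi _] <- phimin]]; apply: gradient_at_min => //.
by apply: filterS phimin => y; rewrite lerD2l lerN2.
Qed.

Lemma superdifferentialDr (c : R) u x :
  superdifferential (fun y => u y + c) x = superdifferential u x.
Proof.
apply/seteqP; split=> p [phi [C1 gp max]]; exists phi; split=> //;
  by apply: filterS max => y; rewrite ![_ + c]addrC -!addrA lerD2l.
Qed.

Lemma subdifferentialDr (c : R) u x :
  subdifferential (fun y => u y + c) x = subdifferential u x.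
Proof.
apply/seteqP; split=> p [phi [C1 gp max]]; exists phi; split=> //;
  by apply: filterS max => y; rewrite ![_ + c]addrC -!addrA lerD2l.
Qed.

(** By periodicity the values on the compact cube [0, 1]^N are all the
    values. *)
Lemma torus_exists_max u : continuous u -> torus_periodic u ->
  exists x, forall y, u y <= u x.
Proof.
move=> cu pu.
pose cube := [set v : 'rV[R]_N | forall i, `[0, 1]%classic (v ord0 i)].
have ccube : compact cube.
  by apply: (@rV_compact R N (fun=> `[0, 1]%classic)) => _; exact: segment_compact.
have cube0 : cube !=set0.
  by exists 0 => i; rewrite /= mxE in_itv/= lexx ler01.
have [x _ xmax] := EVT_max_rV cube0 ccube (continuous_subspaceT cu).
exists x => y; pose k : 'rV[int]_N := \row_i - Num.floor (y ord0 i).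
rewrite -(pu k y); apply: xmax; rewrite inE => i /=.
rewrite !mxE in_itv/= intrN subr_ge0 floor_le/= lerBlDl -[1]/(1%:~R) -intrD.
exact/ltW/floorD1_gt.
Qed.

End Semidifferentials.

(** * Bounds on the critical value *)

Section CriticalValue.
Variables (R : realType) (N m : nat) (G : 'I_m -> 'rV[R]_N -> 'rV[R]_N -> R).
Variable B : 'M[R]_m.
Hypotheses (m_gt0 : (0 < m)%N) (hB : degenerate_coupling_matrix B).

(** Let [M i] be the maximum of [u i], reached at [x i]. There 0 is a
    supergradient of [u i], and since [B] is nonpositive off the diagonal,
    replacing [u j (x i)] by [M j] only decreases the coupling term. In the row of
    the largest [M i] what remains, [(B M) i], is nonnegative, hence
    [G i (x i) 0 <= a]. *)
Lemma subsolution_level_ge (k a : R) (u : 'I_m -> 'rV[R]_N -> R) :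
  (forall i x, k <= G i x 0) -> subsolution G B a u -> k <= a.
Proof.
move=> kG [ctu sub]; case: (hB) => -[Bneg _] _.
have /choice[x xmax] : forall i, exists x, forall y, u i y <= u i x.
  by move=> i; have [] := ctu i; exact: torus_exists_max.
pose M : 'cV[R]_m := \col_i u i (x i).
have [i Mi] := exists_max_entry m_gt0 M.
have := sub (x i) i 0 (superdifferential_at_max (xmax i)).
apply: le_trans; rewrite -[k]addr0; apply: lerD; first exact: kG.
apply: le_trans (coupling_at_max_ge0 hB Mi) _.
rewrite /coupling !mulmx_colE; apply: ler_sum => j _; rewrite !mxE.
have [->//|ji] := eqVneq j i.
by rewrite ler_wnM2l ?Bneg.
Qed.

Lemma subsolution_zero (K : R) : (forall i x, G i x 0 <= K) ->
  subsolution G B K (fun _ _ => 0).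
Proof.
move=> GK; split=> [i|x i p /superdifferential_const ->].
  by split; [exact: cst_continuous | move=> k x].
rewrite /coupling (_ : \col_j _ = const_mx 0); last by apply/colP => j; rewrite !mxE.
by rewrite mulmx_const_eq0// mxE addr0.
Qed.

End CriticalValue.

(** At zero momentum both coercivity bounds are constants. *)
Lemma hamiltonian_bounded_at_zero (R : realType) (N m : nat)
    (H : 'I_m -> 'rV[R]_N -> 'rV[R]_N -> R) :
  (forall i, convex_hamiltonian (H i)) ->
  exists k : R, forall i x, `|H i x 0| <= k.
Proof.
move=> hH.
have /choice[k kP] : forall i, exists k : R, forall x, `|H i x 0| <= k.
  move=> i; have [_ _ _ [alpha [beta [_ _ ab]]]] := hH i.
  pose r := euclidean_norm (0 : 'rV[R]_N).
  exists (`|alpha r| + `|beta r|) => x; have [le_a le_b] := ab x 0.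
  rewrite ler_norml; apply/andP; split.
    apply: le_trans le_a; rewrite lerNl (le_trans (ler_norm _))// normrN.
    by rewrite lerDl.
  by apply: le_trans le_b _; rewrite (le_trans (ler_norm _))// lerDr.
exists (\sum_i `|k i|) => i x; apply: le_trans (kP i x) _.
rewrite (bigD1 i)//=; apply: le_trans (ler_norm _) _.
by rewrite lerDl sumr_ge0.
Qed.

(** * Systems conjugated by a constant shift of the solutions *)

Section Shift.
Variables (R : realType) (N m : nat) (B : 'M[R]_m).
Implicit Types (G : 'I_m -> 'rV[R]_N -> 'rV[R]_N -> R) (v : 'cV[R]_m) (s : R).

(** The relation under which [u |-> u + v] turns the system of [G] at level [a]
    into the system of [G'] at level [a - s]. Unlike the equation between
    [lambda] and [pi lambda] it comes from, it is visibly symmetric, so that each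
    comparison below needs one direction only. *)
Definition shift_conjugate G G' v s : Prop :=
  forall i x p, G' i x p + (B *m v) i 0 = G i x p - s.

Definition shift_by v (u : 'I_m -> 'rV[R]_N -> R) : 'I_m -> 'rV[R]_N -> R :=
  fun i x => u i x + v i 0.

Lemma shift_conjugate_sym {G G' v s} :
  shift_conjugate G G' v s -> shift_conjugate G' G (- v) (- s).
Proof.
move=> GG' i x p; rewrite mulmxN mxE opprK.
by rewrite -[G' i x p](addrK ((B *m v) i 0)) GG' addrAC subrK.
Qed.

Lemma torus_continuous_shift v u :
  torus_continuous u -> torus_continuous (shift_by v u).
Proof.
move=> ctu i; have [cu pu] := ctu i; split=> [x|k x].
  exact: (@cvgD _ _ _ _ _ (u i) (cst (v i 0)) _ _ (cu x) (cvg_cst _)).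
by rewrite /shift_by pu.
Qed.

Lemma coupling_shift v u x : coupling B (shift_by v u) x = coupling B u x + B *m v.
Proof.
by rewrite /coupling -mulmxDr; congr (_ *m _); apply/colP => i; rewrite !mxE.
Qed.

Lemma shifted_equation {G G' v s} (GG' : shift_conjugate G G' v s) u i x p :
  G' i x p + coupling B (shift_by v u) x i 0 = G i x p + coupling B u x i 0 - s.
Proof.
by rewrite coupling_shift [in LHS]mxE [X in _ + X]addrC addrA GG' addrAC.
Qed.

Lemma subsolution_shift {G G' v s} a u :
  shift_conjugate G G' v s -> subsolution G B a u ->
  subsolution G' B (a - s) (shift_by v u).
Proof.
move=> GG' [ctu sub]; split; first exact: torus_continuous_shift.
move=> x i p; rewrite superdifferentialDr (shifted_equation GG') lerD2r.
exact: sub.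
Qed.

Lemma supersolution_shift {G G' v s} a u :
  shift_conjugate G G' v s -> supersolution G B a u ->
  supersolution G' B (a - s) (shift_by v u).
Proof.
move=> GG' [ctu sup]; split; first exact: torus_continuous_shift.
move=> x i p; rewrite subdifferentialDr (shifted_equation GG') lerD2r.
exact: sup.
Qed.

Lemma critical_value_shift_le {G G' v s} :
  shift_conjugate G G' v s ->
  [set a | exists u, subsolution G B a u] !=set0 ->
  has_lbound [set a | exists u, subsolution G' B a u] ->
  critical_value G' B <= critical_value G B - s.
Proof.
move=> GG' G0 G'lb; rewrite lerBrDr; apply: lb_le_inf => // a [u subu].
rewrite -lerBrDr; apply: ge_inf => //; exists (shift_by v u).
exact: subsolution_shift subu.
Qed.

Lemma Phi_shift_le {G G' v s} i j y x :
  shift_conjugate G G' v s -> critical_value G' B = critical_value G B - s ->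
  (Phi G B i j y x + (v i 0 - v j 0)%:E <= Phi G' B i j y x)%E.
Proof.
move=> GG' cE; rewrite -leeBrDr //; apply: ge_ereal_sup => _ [w subw <-].
rewrite leeBrDr // -EFinD; apply: ereal_sup_ubound.
exists (shift_by v w); first by rewrite cE; exact: subsolution_shift subw.
by rewrite /shift_by opprD addrACA.
Qed.

Lemma Phi_shift {G G' v s} i j y x :
  shift_conjugate G G' v s -> critical_value G' B = critical_value G B - s ->
  (Phi G' B i j y x = Phi G B i j y x + (v i 0 - v j 0)%:E)%E.
Proof.
move=> GG' cE; apply/eqP; rewrite eq_le (Phi_shift_le i j y x GG' cE) andbT.
have cE' : critical_value G B = critical_value G' B - - s by rewrite cE opprK subrK.
have := Phi_shift_le i j y x (shift_conjugate_sym GG') cE'.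
by rewrite !mxE -opprD EFinN leeBlDr.
Qed.

(** As a function of [i], [Phi] is shifted by [v i - v j] rather than by [v i].
    This is still an admissible shift because [B] kills constants. *)
Lemma aubry_set_shift_sub {G G' v s} j : degenerate_coupling_matrix B ->
  shift_conjugate G G' v s -> critical_value G' B = critical_value G B - s ->
  aubry_set G B j `<=` aubry_set G' B j.
Proof.
move=> hB GG' cE y [u [Phiu [subu supu]]].
have GG'j : shift_conjugate G G' (v - const_mx (v j 0)) s.
  by move=> i x p; rewrite mulmxBr mulmx_const_eq0// subr0.
exists (shift_by (v - const_mx (v j 0)) u); split.
  by move=> i x; rewrite (Phi_shift i j y x GG' cE) Phiu /shift_by !mxE.
by rewrite cE; split; [exact: subsolution_shift subu | exact: supersolution_shift supu].
Qed.

End Shift.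

Unset Implicit Arguments.

Theorem proposition6p2 (R : realType) (N m : nat) (hN : (0 < N)%N) (hm : (0 < m)%N)
    (H : 'I_m -> 'rV[R]_N -> 'rV[R]_N -> R) (B : 'M[R]_m)
    (hH : forall i, convex_hamiltonian (H i))
    (hB : degenerate_coupling_matrix B) (hirr : irreducible_matrix B) :
  exists pi : 'cV[R]_m -> R,
    (forall lambda : 'cV[R]_m,
       unique (fun a : R => exists v : 'cV[R]_m, lambda - const_mx a = B *m v)
              (pi lambda)) /\
    (forall lambda : 'cV[R]_m,
       let Hl (mu : 'cV[R]_m) := fun i x p => H i x p - mu i 0 in
       critical_value (Hl lambda) B = critical_value (Hl 0) B - pi lambda /\
       forall j : 'I_m, aubry_set (Hl lambda) B j = aubry_set (Hl 0) B j).
Proof.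
have /choice[pi piP] := exists_const_mod_range hm hB hirr.
exists pi; split=> [l|l Hl].
  split; first exact: piP.
  by move=> a [w lw]; have [v lv] := piP l; exact: const_mod_range_inj lv lw.
have [v lv] := piP l.
have Hl_shift : shift_conjugate B (Hl 0) (Hl l) v (pi l).
  by move=> i x p; rewrite /Hl -lv !mxE subr0 addrA subrK.
have [k Hk] := hamiltonian_bounded_at_zero hH.
have levels_nonempty mu : [set a | exists u, subsolution (Hl mu) B a u] !=set0.
  exists (k + \sum_i `|mu i 0|), (fun _ _ => 0).
  apply: subsolution_zero => // i x.
  apply: lerD; first exact: le_trans (ler_norm _) (Hk i x).
  rewrite (bigD1 i)//= -[leLHS]addr0; apply: lerD; last exact: sumr_ge0.
  by rewrite -normrN ler_norm.
have levels_bounded mu : has_lbound [set a | exists u, subsolution (Hl mu) B a u].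
  exists (- k - \sum_i `|mu i 0|) => a [u subu].
  apply: subsolution_level_ge subu => // i x; apply: lerD.
    by have := Hk i x; rewrite ler_norml => /andP[].
  rewrite lerN2 (bigD1 i)//= -[leLHS]addr0.
  by apply: lerD; [exact: ler_norm | exact: sumr_ge0].
have cE : critical_value (Hl l) B = critical_value (Hl 0) B - pi l.
  apply/eqP; rewrite eq_le (critical_value_shift_le Hl_shift)//= lerBlDr.
  by rewrite -[X in _ + X]opprK (critical_value_shift_le (shift_conjugate_sym Hl_shift)).
split=> // j; apply/seteqP; split.
  apply: (aubry_set_shift_sub hB (shift_conjugate_sym Hl_shift)) => //.
  by rewrite cE opprK subrK.
exact: (aubry_set_shift_sub hB Hl_shift).
Qed.
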